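(* Let $\varepsilon>0$ be a fixed constant and let $\psi\in\mathfrak C$. If $C$ is spectrally coercive with $\varepsilon,\psi$ (that is, with the constant function $\varepsilon$ and the function $\psi$), then $C$ is weakly spectrally coercive. Conversely, if $C$ is weakly spectrally coercive with $\varepsilon,\psi$, then $C$ is spectrally coercive.
   Context: $X$ and $Y$ are complex Hilbert spaces. $A$ is an unbounded self-adjoint, strictly positive operator on $X$ with compact resolvent, with eigenvalues $(\lambda_k)_{k\in\mathbb N^*}$ (repeated according to multiplicity, in nondecreasing order) and an associated orthonormal basis of eigenvectors $(\phi_k)_{k\in\mathbb N^*}$. $X_2=D(A)$ with the norm $\|z\|_2=\|Az\|_X$, and $(e^{itA})_{t\in\mathbb R}$ is the unitary group generated by $iA$. $C\in\mathcal L(X_2,Y)$ is bounded and admissible: for every $T>0$ there is $C_T>0$ such that $\int_0^T\|Ce^{itA}z_0\|_Y^2dt\le C_T\|z_0\|_X^2$ for all $z_0\in X_2$. For $z\in X_2\setminus\{0\}$ the $A$-frequency is $\lambda(z)=\langle Az,z\rangle_X\|z\|_X^{-2}$. $\mathfrak C$ is the set of continuous decreasing functions $\psi:\mathbb R_+\to(0,\infty)$, ''decreasing'' in the non-strict sense (constant functions belong to $\mathfrak C$). $C$ is spectrally coercive with $\varepsilon,\psi\in\mathfrak C$ if, whenever $z\in X_2\setminus\{0\}$ satisfies $\frac{\|Az\|_X^2}{\|z\|_X^2}-\lambda^2(z)<\varepsilon(\lambda(z))$, one has $\|Cz\|_Y^2\ge\psi(\lambda(z))\|z\|_X^2$. $C$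 is spectrally coercive if this holds for some $\varepsilon,\psi\in\mathfrak C$. For $\lambda\in\mathbb R_+$ and $\varepsilon>0$ put $N_\varepsilon(\lambda)=\{k\in\mathbb N^*:\ |\lambda-\lambda_k|<\varepsilon\}$. $C$ is weakly spectrally coercive with the constant $\varepsilon>0$ and $\psi\in\mathfrak C$ if for all $\lambda\in\mathbb R_+$ the inequality $\|Cz\|_Y^2\ge\psi(\lambda)\|z\|_X^2$ holds for all $z=\sum_{k\in N_\varepsilon(\lambda)}z_k\phi_k\in X_2\setminus\{0\}$. $C$ is weakly spectrally coercive if this holds for some constant $\varepsilon>0$ and some $\psi\in\mathfrak C$. *)

(* Defs.v *)
From HB Require Import structures.
From mathcomp Require Import all_boot all_order all_algebra.
From mathcomp Require Import sesquilinear.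
From mathcomp Require Import all_classical all_reals all_analysis.
From mathcomp.real_closed Require Import complex.

Set Implicit Arguments.
Unset Strict Implicit.
Unset Printing Implicit Defensive.

Import Order.TTheory GRing.Theory Num.Theory.
Import numFieldNormedType.Exports.

Local Open Scope classical_set_scope.
Local Open Scope ring_scope.
Local Open Scope complex_scope.

(* The inner product is linear in its first argument and conjugate-linear in
   its second one. *)
HB.mixin Record CompleteNormedModule_isHilbert (R : realType) H
    of CompleteNormedModule R[i] H := {
  inner : {dot H for (@Num.conj R[i])} ;
  inner_norm : forall x : H, `|x| ^+ 2 = inner x x }.

#[short(type="hilbertType")]
HB.structure Definition Hilbert (R : realType) :=
  { H of CompleteNormedModule R[i] H & CompleteNormedModule_isHilbert R H }.

(* The norm of a normed module over R[i] takes its values in R[i]. *)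
Definition rnorm (R : realType) (V : normedModType R[i]) (x : V) : R :=
  complex.Re `|x|.

(* An unbounded operator is given by its domain D and a total function A whose
   values outside D are irrelevant. *)
Section UnboundedOperators.
Context {R : realType} {X : hilbertType R}.
Implicit Types (D : set X) (A : X -> X) (U : R -> X -> X).

Definition linear_subspace D : Prop :=
  D 0 /\ forall (a : R[i]) x y, D x -> D y -> D (a *: x + y).

Definition linear_on D (V : lmodType R[i]) (f : X -> V) : Prop :=
  forall (a : R[i]) x y, D x -> D y -> f (a *: x + y) = a *: f x + f y.

(* (y, w) belongs to the graph of the adjoint. *)
Definition adjoint_graph D A (y w : X) : Prop :=
  forall x, D x -> inner (A x) y = inner x w.

Definition self_adjoint D A : Prop :=
  dense D /\ forall y w, adjoint_graph D A y w <-> (D y /\ A y = w).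

Definition strictly_positive D A : Prop :=
  forall z, D z -> z <> 0 -> 0 < inner (A z) z.

Definition compact_operator (S : X -> X) : Prop :=
  linear S /\ precompact (S @` [set x | `|x| <= 1]).

Definition has_compact_resolvent D A : Prop :=
  exists (mu : R[i]) (S : X -> X),
    [/\ forall x, D (S x) /\ A (S x) - mu *: S x = x,
        forall z, D z -> S (A z - mu *: z) = z
      & compact_operator S].

Definition orthonormal_basis (phi : nat -> X) : Prop :=
  (forall j k, inner (phi j) (phi k) = (j == k)%:R) /\
  dense [set z | exists (n : nat) (c : nat -> R[i]),
                   z = \sum_(0 <= k < n) c k *: phi k].

Definition unitary_group U : Prop :=
  [/\ forall z, U 0 z = z,
      forall s t z, U (s + t) z = U s (U t z),
      forall t, linear (U t),
      forall t x y, inner (U t x) (U t y) = inner x y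
    & forall z, continuous (fun t : R => U t z)].

(* The infinitesimal generator of U is 'i A, with the domain D. *)
Definition generated_by_i D A U : Prop :=
  forall z w : X, (D z /\ 'i *: A z = w) <->
    ((h^-1)%:C *: (U h z - z) @[h --> (0 : R)^'] --> w).

End UnboundedOperators.

Section SpectralCoercivity.
Context {R : realType} {X Y : hilbertType R}.
Implicit Types (D : set X) (A : X -> X) (C : X -> Y) (U : R -> X -> X).
Implicit Types (lam : nat -> R) (phi : nat -> X) (eps psi : R -> R).

(* C is a bounded operator from D, with the norm |A z|, to Y. *)
Definition bounded_on_domain D A C : Prop :=
  linear_on D C /\ exists M : R, forall z, D z -> rnorm (C z) <= M * rnorm (A z).

Definition admissible D C U : Prop :=
  forall T : R, 0 < T -> exists2 CT : R, 0 < CT & forall z, D z ->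
    (\int[lebesgue_measure]_(t in `[0%R, T]) (rnorm (C (U t z)) ^+ 2)%:E
      <= (CT * rnorm z ^+ 2)%:E)%E.

Definition frequency A (z : X) : R := complex.Re (inner (A z) z) / rnorm z ^+ 2.

(* Functions on the half-line are total functions whose values at negative
   numbers are irrelevant. *)
Definition decreasing_class psi : Prop :=
  [/\ {within `[0, +oo[, continuous psi},
      forall x y : R, 0 <= x -> x <= y -> psi y <= psi x
    & forall x : R, 0 <= x -> 0 < psi x].

Definition spectrally_coercive_with D A C eps psi : Prop :=
  forall z, D z -> z <> 0 ->
    rnorm (A z) ^+ 2 / rnorm z ^+ 2 - frequency A z ^+ 2
      < eps (frequency A z) ->
    psi (frequency A z) * rnorm z ^+ 2 <= rnorm (C z) ^+ 2.

Definition spectrally_coercive D A C : Prop :=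
  exists eps psi, [/\ decreasing_class eps, decreasing_class psi
    & spectrally_coercive_with D A C eps psi].

(* Indices start at 0: lam k and phi k are the (k+1)-st eigenvalue and
   eigenvector. *)
Definition near_indices lam (e l : R) : set nat :=
  [set k | `|l - lam k| < e].

Definition weakly_spectrally_coercive_with D lam phi C (e : R) psi : Prop :=
  forall l : R, 0 <= l -> forall (c : nat -> R[i]) (z : X),
    \sum_(0 <= k < n | k \in near_indices lam e l) c k *: phi k
      @[n --> \oo] --> z ->
    D z -> z <> 0 ->
    psi l * rnorm z ^+ 2 <= rnorm (C z) ^+ 2.

Definition weakly_spectrally_coercive D lam phi C : Prop :=
  exists (e : R) psi, [/\ 0 < e, decreasing_class psi
    & weakly_spectrally_coercive_with D lam phi C e psi].

End SpectralCoercivity.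

(* Main.v *)
(* By the Pythagorean identity |(A - l) z|^2 = |(A - f) z|^2 + (l - f)^2 |z|^2,
   f being the frequency of z, the spectral variance is |(A - f) z|^2 / |z|^2.
   If z is supported on frequencies within e of l, then |(A - l) z| <= e |z|, so
   the variance is at most e^2 and f <= l + e: this gives the weak inequality
   with psi (l + e), as soon as e^2 < eps.
   Conversely, split z at its frequency f into a near part z1, with frequencies
   within eps of f, and a far part z2. Then eps |z2| and |(A - f) z2| are both
   at most |(A - f) z|, hence |C z2| <= M |A z2| is small compared with
   sqrt (psi f) |z| when the variance is a small multiple of
   psi f / (eps + f)^2, and C z1 dominates. *)
Require Import Defs.
From mathcomp Require Import all_boot all_order all_algebra.
From mathcomp Require Import sesquilinear.
From mathcomp Require Import all_classical all_reals all_analysis.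
From mathcomp.real_closed Require Import complex.
From mathcomp Require Import ring lra.

Import Order.TTheory GRing.Theory Num.Theory.
Import numFieldNormedType.Exports.

Local Open Scope classical_set_scope.
Local Open Scope ring_scope.
Local Open Scope complex_scope.

(** * Passage from the [R[i]]-valued norm to the real norm [rnorm] *)

Lemma norm_real_complex {R : realType} (x : R) : `|x%:C| = `|x|%:C.
Proof. by rewrite normc_def /= expr0n addr0 sqrtr_sqr. Qed.

Lemma rnormE {R : realType} {V : normedModType R[i]} (x : V) :
  (rnorm x)%:C = `|x|.
Proof. by rewrite /rnorm RRe_real // ger0_real. Qed.

Lemma rnorm_ge0 {R : realType} {V : normedModType R[i]} (x : V) : 0 <= rnorm x.
Proof. by rewrite -lecR rnormE; exact: normr_ge0. Qed.

Lemma rnorm_gt0 {R : realType} {V : normedModType R[i]} (x : V) :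
  x <> 0 -> 0 < rnorm x.
Proof. by move=> /eqP x0; rewrite -ltcR rnormE; rewrite normr_gt0. Qed.

Lemma rnormD {R : realType} {V : normedModType R[i]} (x y : V) :
  rnorm (x + y) <= rnorm x + rnorm y.
Proof. by rewrite -lecR rmorphD /= !rnormE ler_normD. Qed.

Lemma rnormN {R : realType} {V : normedModType R[i]} (x : V) :
  rnorm (- x) = rnorm x.
Proof. by apply: complexI; rewrite !rnormE normrN. Qed.

Lemma rnormZ {R : realType} {V : normedModType R[i]} (a : R) (x : V) :
  rnorm (a%:C *: x) = `|a| * rnorm x.
Proof.
by apply: complexI; rewrite rmorphM /= !rnormE normrZ norm_real_complex.
Qed.

(** * Fourier coefficients and Fourier sums in an orthonormal basis *)

Section Orthonormal.
Context {R : realType} {X : hilbertType R} {phi : nat -> X}.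
Hypothesis phi_orthonormal : forall j k, inner (phi j) (phi k) = (j == k)%:R.
Implicit Types (x y : X) (c : nat -> R[i]) (P : pred nat).

Lemma normD_orthogonal x y :
  inner x y = 0 -> `|x + y| ^+ 2 = `|x| ^+ 2 + `|y| ^+ 2.
Proof. by move=> xy0; rewrite !inner_norm hnormDd. Qed.

Lemma coef_sum n P c j :
  inner (\sum_(0 <= k < n | P k) c k *: phi k) (phi j) =
  if (j < n)%N && P j then c j else 0.
Proof.
rewrite linear_sumlz.
under eq_bigr do rewrite linearZl_LR /= phi_orthonormal.
case: ifPn => [/andP[jn Pj]|].
  rewrite big_mkcond (bigD1_seq j) ?mem_index_iota ?iota_uniq //= Pj eqxx mulr1.
  by rewrite big1 ?addr0 // => i /negPf ->; rewrite mulr0 if_same.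
rewrite negb_and => jnP.
rewrite big_nat_cond big1 // => i /andP[/andP[_ i_n] Pi].
case: eqP => [ij|_]; last exact: mulr0.
by move: jnP; rewrite -ij i_n Pi.
Qed.

Lemma inner_sumr_eq0 n P c x :
  (forall k, (k < n)%N -> inner x (phi k) = 0) ->
  inner x (\sum_(0 <= k < n | P k) c k *: phi k) = 0.
Proof.
move=> x0; rewrite linear_sumr big_nat_cond big1 // => i /andP[/andP[_ i_n] _].
by rewrite linearZr_LR /= x0 // mulr0.
Qed.

Lemma sqr_norm_sum n c :
  `|\sum_(0 <= k < n) c k *: phi k| ^+ 2 = \sum_(0 <= k < n) `|c k| ^+ 2.
Proof.
rewrite inner_norm linear_sumr; apply: eq_big_nat => i /andP[_ i_n].
by rewrite linearZr_LR /= coef_sum i_n /= normCKC.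
Qed.

Definition fourier_sum n x := \sum_(0 <= k < n) inner x (phi k) *: phi k.

Lemma coef_fourier_sum n x k : (k < n)%N ->
  inner (x - fourier_sum n x) (phi k) = 0.
Proof. by move=> kn; rewrite linearBl /= /fourier_sum coef_sum kn subrr. Qed.

(** Pythagoras for the orthogonal pair [x - fourier_sum n x] and [fourier_sum n x]. *)
Lemma bessel n x : \sum_(0 <= k < n) `|inner x (phi k)| ^+ 2 <= `|x| ^+ 2.
Proof.
rewrite -sqr_norm_sum -[in leRHS](subrK (fourier_sum n x) x).
rewrite normD_orthogonal ?lerDr ?exprn_ge0 //.
apply: inner_sumr_eq0 => k; exact: coef_fourier_sum.
Qed.

Lemma coef_le x k : `|inner x (phi k)| <= `|x|.
Proof.
rewrite -ler_sqr ?nnegrE //; apply: le_trans (bessel k.+1 x).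
by rewrite big_nat_recr //= lerDr sumr_ge0 // => i _; apply: exprn_ge0.
Qed.

(** The residual [x - fourier_sum m x] is orthogonal to every [phi k] with [k < m], so Pythagoras
    applies. Allowing [n <= m] lets one approximant control all later Fourier sums. *)
Lemma fourier_sum_best n m c x : (n <= m)%N ->
  `|x - fourier_sum m x| <= `|x - \sum_(0 <= k < n) c k *: phi k|.
Proof.
move=> nm; rewrite -ler_sqr ?nnegrE //.
set p := (X in _ <= `|x - X| ^+ 2).
rewrite -[x - p](subrKA (fourier_sum m x)) [leRHS]normD_orthogonal.
  by rewrite lerDl exprn_ge0.
have x0 k : (k < m)%N -> inner (x - fourier_sum m x) (phi k) = 0.
  exact: coef_fourier_sum.
rewrite linearBr /= !inner_sumr_eq0 ?subrr // => k kn.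
by apply: x0; apply: leq_trans nm.
Qed.

Hypothesis phi_total : dense [set z | exists (n : nat) (c : nat -> R[i]),
  z = \sum_(0 <= k < n) c k *: phi k].

Lemma cvg_fourier_sum x : fourier_sum n x @[n --> \oo] --> x.
Proof.
apply/cvgrPdist_lt => e e0.
have [] := phi_total (ball x e).
- by exists x; exact: ballxx.
- exact: ball_open.
move=> y [xy [n [c yE]]].
near=> m; apply: le_lt_trans (fourier_sum_best n m c x _) _.
  by near: m; exact: nbhs_infty_ge.
by rewrite -yE; move: xy; rewrite -ball_normE.
Unshelve. all: by end_near. Qed.

(** Bessel's inequality for [y] bounds the Fourier sums of [x], whose remainder is eventually below
    any [e]. Norm estimates on [A z - l%:C *: z] reduce to such diagonal comparisons. *)
Lemma norm_le_coef (M : R[i]) x y : 0 <= M ->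
  (forall k, `|inner x (phi k)| <= M * `|inner y (phi k)|) ->
  `|x| <= M * `|y|.
Proof.
move=> M0 xy; apply/ler_addgt0Pr => e e0.
have /cvgrPdist_lt/(_ e e0) [n _ /(_ n (leqnn n)) /= xn] := cvg_fourier_sum x.
rewrite -[in leLHS](subrK (fourier_sum n x) x).
apply: le_trans (ler_normD _ _) _; rewrite [leLHS]addrC.
apply: lerD (ltW xn).
rewrite -ler_sqr ?nnegrE ?mulr_ge0 //.
rewrite sqr_norm_sum exprMn.
apply: le_trans (ler_wpM2l _ (bessel n y)); last exact: exprn_ge0.
rewrite mulr_sumr ler_sum // => k _.
by rewrite -exprMn ler_sqr ?nnegrE ?mulr_ge0.
Qed.

(** The [k]-th coefficient vanishes on every partial sum and is 1-Lipschitz by [coef_le], so it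
    vanishes in the limit. *)
Lemma coef_cvg_eq0 P c z k :
  \sum_(0 <= k < n | P k) c k *: phi k @[n --> \oo] --> z ->
  ~~ P k -> inner z (phi k) = 0.
Proof.
move=> /cvgrPdist_lt zP Pk; apply/eqP; rewrite -normr_le0.
apply/ler_addgt0Pr => e e0; rewrite add0r.
have [n _ /(_ n (leqnn n)) /= zn] := zP e e0.
apply: le_trans (ltW zn); apply: le_trans (coef_le _ k).
by rewrite linearBl /= coef_sum (negPf Pk) andbF subr0.
Qed.

End Orthonormal.

(** * The frequency and the norm of [A - l] *)

Section SpectralShift.
Context {R : realType} {X : hilbertType R} {D : set X} {A : X -> X}.
Hypothesis A_self_adjoint : self_adjoint D A.
Hypothesis A_positive : strictly_positive D A.
Implicit Types (l : R) (z : X).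

Lemma self_adjoint_symmetric x y : D x -> D y -> inner (A x) y = inner x (A y).
Proof. by case: A_self_adjoint => _ /(_ y (A y)) [_ h] Dx Dy; apply: h. Qed.

(** A positive element of [R[i]] is real, so strict positivity makes the real part in [frequency]
    harmless. *)
Lemma inner_frequency z : D z -> z <> 0 ->
  inner (A z) z = (frequency A z * rnorm z ^+ 2)%:C.
Proof.
move=> Dz z0; rewrite /frequency divfK ?expf_neq0 ?gt_eqF ?rnorm_gt0 //.
by rewrite RRe_real // ger0_real // ltW // A_positive.
Qed.

Lemma frequency_ge0 z : D z -> z <> 0 -> 0 <= frequency A z.
Proof.
move=> Dz z0; have := ltW (A_positive z Dz z0).
by rewrite inner_frequency // lecR pmulr_lge0 // exprn_gt0 // rnorm_gt0.
Qed.

(** The cross terms are real by [inner_frequency]. At [l = frequency A z] the right side is the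
    spectral variance times [rnorm z ^+ 2]. *)
Lemma sqr_rnorm_shift l z : D z -> z <> 0 ->
  rnorm (A z - l%:C *: z) ^+ 2 =
  rnorm (A z) ^+ 2 + (l ^+ 2 - l * frequency A z *+ 2) * rnorm z ^+ 2.
Proof.
move=> Dz z0; apply: complexI.
rewrite rmorphXn /= rnormE inner_norm dnormB dnormZ linearZr_LR /=.
rewrite inner_frequency // -!inner_norm -!rnormE.
have -> : `|l%:C| ^+ 2 = (l ^+ 2)%:C.
  by rewrite normCK rmorphXn expr2; congr (_ * _); exact: conjc_real.
have -> : (l%:C)^*%R * (frequency A z * rnorm z ^+ 2)%:C =
    (l * (frequency A z * rnorm z ^+ 2))%:C.
  by rewrite [RHS]rmorphM; congr (_ * _); exact: conjc_real.
have -> : ((l * (frequency A z * rnorm z ^+ 2))%:C)^*%R =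
    (l * (frequency A z * rnorm z ^+ 2))%:C by exact: conjc_real.
ring.
Qed.

End SpectralShift.

(* Monotonicity of lam makes either the near indices or the far ones finite in
   number, so the spectral projection of a vector of the domain stays in the
   domain. *)
Lemma nondecreasing_near_indices {R : realType} (lam : nat -> R) (e l : R) :
  nondecreasing_seq lam ->
  exists (b : bool) (n : nat),
    forall k, (n <= k)%N -> (k \in near_indices lam e l) = b.
Proof.
move=> lam_nd.
have [[n lam_n]|lam_lt] := pselect (exists n, l + e <= lam n).
  exists false, n => k nk; apply/negP; rewrite in_setE /near_indices /=.
  by have := lam_nd _ _ nk; rewrite ltr_norml; lra.
have [[n lam_n]|lam_le] := pselect (exists n, l - e < lam n).
  exists true, n => k nk; apply/mem_set; rewrite /near_indices /=.
  have lam_k : lam k < l + e.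
    by rewrite ltNge; apply/negP => ?; apply: lam_lt; exists k.
  by have := lam_nd _ _ nk; rewrite ltr_norml; lra.
exists false, 0%N => k _; apply/negP; rewrite in_setE /near_indices /=.
rewrite ltr_norml => lam_k; apply: lam_le; exists k; lra.
Qed.

(** * Near and far spectral parts of a vector of the domain *)

Section SpectralSplitting.
Context {R : realType} {X : hilbertType R} {D : set X} {A : X -> X}.
Context {lam : nat -> R} {phi : nat -> X}.
Hypothesis D_subspace : linear_subspace D.
Hypothesis A_self_adjoint : self_adjoint D A.
Hypothesis A_positive : strictly_positive D A.
Hypothesis lam_nondecreasing : nondecreasing_seq lam.
Hypothesis phi_basis : orthonormal_basis phi.
Hypothesis phi_eigen : forall k, D (phi k) /\ A (phi k) = (lam k)%:C *: phi k.
Implicit Types (l e : R) (z : X).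

Lemma domainD x y : D x -> D y -> D (x + y).
Proof. by move=> Dx Dy; rewrite -[x]scale1r; apply: D_subspace.2. Qed.

Lemma domainB x y : D x -> D y -> D (x - y).
Proof. by move=> Dx Dy; rewrite addrC -scaleN1r; apply: D_subspace.2. Qed.

Lemma domain_sum n (P : pred nat) (c : nat -> R[i]) :
  D (\sum_(0 <= k < n | P k) c k *: phi k).
Proof.
apply: (big_ind D); [exact: D_subspace.1 | exact: domainD |].
move=> k _; rewrite -[_ *: _]addr0; apply: D_subspace.2.
  exact: (phi_eigen k).1.
exact: D_subspace.1.
Qed.

(** Symmetry moves [A] onto [phi k], where it acts as the real scalar [lam k]. *)
Lemma coef_shift l z k : D z ->
  inner (A z - l%:C *: z) (phi k) = (lam k - l)%:C * inner z (phi k).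
Proof.
move=> Dz; have [Dphi Aphi] := phi_eigen k.
rewrite linearBl /= linearZl_LR /= (self_adjoint_symmetric A_self_adjoint) //.
rewrite Aphi linearZr_LR /= rmorphB mulrBl; congr (_ * _ - _).
exact: conjc_real.
Qed.

Lemma rnorm_le_coef (M : R) (x y : X) : 0 <= M ->
  (forall k, `|inner x (phi k)| <= M%:C * `|inner y (phi k)|) ->
  rnorm x <= M * rnorm y.
Proof.
move=> M0 xy; rewrite -lecR rmorphM /= !rnormE.
by apply: (norm_le_coef phi_basis.1 phi_basis.2) => //; rewrite ler0c.
Qed.

Lemma spectral_spread l e z : 0 <= e -> D z -> z <> 0 ->
  (forall k, k \notin near_indices lam e l -> inner z (phi k) = 0) ->
  rnorm (A z) ^+ 2 / rnorm z ^+ 2 - frequency A z ^+ 2 <= e ^+ 2 /\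
  frequency A z <= l + e.
Proof.
move=> e0 Dz z0 zN; have z_gt0 := rnorm_gt0 _ z0.
have shift_le : rnorm (A z - l%:C *: z) <= e * rnorm z.
  apply: rnorm_le_coef => // k; rewrite coef_shift // normrM.
  have [/set_mem /= lk|/zN ->] := boolP (k \in near_indices lam e l); last first.
    by rewrite normr0 !mulr0.
  by rewrite ler_wpM2r // norm_real_complex lecR distrC ltW.
have : rnorm (A z - l%:C *: z) ^+ 2 <= e ^+ 2 * rnorm z ^+ 2.
  by rewrite -exprMn ler_sqr ?nnegrE ?mulr_ge0 ?rnorm_ge0.
rewrite (sqr_rnorm_shift A_positive) //.
have : 0 <= rnorm (A z - (frequency A z)%:C *: z) ^+ 2 by exact: sqr_ge0.
rewrite (sqr_rnorm_shift A_positive) //.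
have zz : 0 < rnorm z ^+ 2 by rewrite exprn_gt0.
have -> : rnorm (A z) ^+ 2 = rnorm (A z) ^+ 2 / rnorm z ^+ 2 * rnorm z ^+ 2.
  by rewrite divfK // gt_eqF.
rewrite mulfK ?gt_eqF //; move: (_ / _) (frequency A z) => a f.
(* [h1] amounts to [a - f ^+ 2 >= 0] and [h2] to [(a - f ^+ 2) + (f - l) ^+ 2 <= e ^+ 2]; dropping
   either nonnegative term gives one of the two claims. *)
rewrite -!mulrDl pmulr_lge0 // ler_pM2r // => h1 h2; split.
  by have := sqr_ge0 (f - l); nra.
rewrite leNgt; apply/negP => fl.
have : e ^+ 2 < (f - l) ^+ 2 by rewrite ltr_sqr ?nnegrE; lra.
by nra.
Qed.

Lemma spectral_split l e z : D z -> exists z1 z2 : X,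
  [/\ z = z1 + z2, D z1, D z2,
      \sum_(0 <= k < n | k \in near_indices lam e l) inner z (phi k) *: phi k
        @[n --> \oo] --> z1
    & forall k, inner z2 (phi k) =
        if k \in near_indices lam e l then 0 else inner z (phi k)].
Proof.
move=> Dz; set N := near_indices lam e l; set c := fun k => inner z (phi k).
have [b [n0 Nb]] := nondecreasing_near_indices lam e l lam_nondecreasing.
have [phi_on phi_total] := phi_basis.
have tail (P : pred nat) n : (n0 <= n)%N ->
    (forall k, (n0 <= k)%N -> P k = false) ->
    \sum_(0 <= k < n | P k) c k *: phi k = \sum_(0 <= k < n0 | P k) c k *: phi k.
  move=> n0n Pf; rewrite (big_cat_nat (leq0n n0) n0n) /= [X in _ + X]big_nat_cond.
  by rewrite [X in _ + X]big1 ?addr0 // => k /andP[/andP[n0k _]]; rewrite Pf.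
(* If [b] is true, only finitely many indices are far: the far part is a finite sum and the near
   part is obtained by subtraction. Otherwise the roles are exchanged. *)
case: b Nb => Nb.
- pose z2 := \sum_(0 <= k < n0 | k \notin N) c k *: phi k.
  exists (z - z2), z2; split; first by rewrite subrK.
  + by apply: domainB => //; exact: domain_sum.
  + exact: domain_sum.
  + apply: cvg_trans (cvgB (cvg_fourier_sum phi_on phi_total z) (cvg_cst z2)).
    apply: near_eq_cvg; near=> n => /=.
    rewrite !fctE /fourier_sum [in LHS](bigID (fun k => k \in N)) /=.
    rewrite [X in _ + X - _](_ : _ = z2) ?addrK //.
    apply: (tail (fun k => k \notin N)) => [|k /Nb -> //].
    by near: n; exact: nbhs_infty_ge.
  + move=> k; rewrite coef_sum //; case: ifPn => [/andP[_ /negPf ->] //|].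
    by rewrite negb_and negbK -leqNgt => /orP[/Nb ->|->].
- pose z1 := \sum_(0 <= k < n0 | k \in N) c k *: phi k.
  exists z1, (z - z1); split; first by rewrite subrKC.
  + exact: domain_sum.
  + by apply: domainB => //; exact: domain_sum.
  + apply: cvg_near_cst; near=> n.
    by rewrite tail //; near: n; exact: nbhs_infty_ge.
  + move=> k; rewrite linearBl /= coef_sum //; case: ifPn => [/andP[_ ->]|].
      by rewrite subrr.
    rewrite subr0 negb_and -leqNgt => /orP[/Nb ->|/negPf ->] //.
Unshelve. all: by end_near. Qed.

(** Far indices satisfy [e <= |lam k - l|], whence the first bound; the second holds because [z2]
    only erases coefficients of [z]. *)
Lemma spectral_tail l e z z2 : 0 < e -> D z -> D z2 ->
  (forall k, inner z2 (phi k) =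
     if k \in near_indices lam e l then 0 else inner z (phi k)) ->
  e * rnorm z2 <= rnorm (A z - l%:C *: z) /\
  rnorm (A z2 - l%:C *: z2) <= rnorm (A z - l%:C *: z).
Proof.
move=> e0 Dz Dz2 z2E; split.
  rewrite mulrC -ler_pdivlMr // [leRHS]mulrC.
  apply: rnorm_le_coef => [|k]; first by rewrite invr_ge0 ltW.
  rewrite coef_shift // z2E normrM; case: ifPn => [_|].
    by rewrite normr0 !mulr_ge0 // ler0c invr_ge0 ltW.
  move=> /negP kN; rewrite mulrA ler_peMl // norm_real_complex -rmorphM lecR.
  rewrite mulrC ler_pdivlMr // mul1r distrC leNgt.
  by apply/negP => lk; apply: kN; apply: mem_set.
rewrite -[leRHS]mul1r; apply: rnorm_le_coef => // k.
rewrite mul1r !coef_shift // z2E; case: ifPn => // _.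
by rewrite mulr0 normr0.
Qed.

End SpectralSplitting.

(** * Stability properties of the class of continuous decreasing positive functions *)

Section DecreasingClass.
Context {R : realType}.
Implicit Types (psi : R -> R).

Lemma decreasing_class_shift psi (e : R) : 0 <= e -> decreasing_class psi ->
  decreasing_class (fun l => psi (l + e)).
Proof.
move=> e0 [psi_cts psi_dec psi_gt0]; split.
- have shift_cts : continuous (fun l : R => l + e).
    move=> l; apply: (@continuousD _ _ _ id (cst e)); [exact: cvg_id|exact: cst_continuous].
  apply/subspace_continuousP => x /=; rewrite in_itv /= andbT => x0.
  (* [psi] is continuous only relative to the half-line, so the translation must respect the
     relative neighbourhoods; it does since [e >= 0]. *)
  apply: (@cvg_comp _ _ _ (fun l => l + e) psi _ (within `[0, +oo[ (nbhs (x + e)))).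
    move=> B /(shift_cts x) xB.
    have {}xB : \forall l \near x, l + e \in `[0, +oo[ -> B (l + e) by [].
    change (\forall l \near x, l \in `[0, +oo[ -> B (l + e)).
    near=> l; rewrite in_itv /= andbT => l0.
    by apply: (near xB l) => //; rewrite in_itv /= andbT addr_ge0.
  move/subspace_continuousP: psi_cts; apply.
  by rewrite /= in_itv /= andbT addr_ge0.
- by move=> x y x0 xy; apply: psi_dec; [rewrite addr_ge0 | rewrite lerD2r].
- by move=> x x0; apply: psi_gt0; rewrite addr_ge0.
Unshelve. all: by end_near. Qed.

Lemma decreasing_class_scale psi (k : R) : 0 < k -> decreasing_class psi ->
  decreasing_class (fun l => k * psi l).
Proof.
move=> k0 [psi_cts psi_dec psi_gt0]; split.
- apply/subspace_continuousP => x x0; apply: cvgMr.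
  by move/subspace_continuousP: psi_cts; apply.
- by move=> x y x0 xy; rewrite ler_pM2l // psi_dec.
- by move=> x x0; rewrite mulr_gt0 // psi_gt0.
Qed.

Lemma decreasing_class_div psi (e : R) : 0 < e -> decreasing_class psi ->
  decreasing_class (fun l => psi l / (e + l) ^+ 2).
Proof.
move=> e0 [psi_cts psi_dec psi_gt0].
have el0 l : 0 <= l -> 0 < (e + l) ^+ 2.
  by move=> l0; rewrite exprn_gt0 // ltr_wpDr.
split.
- apply/subspace_continuousP => x xI.
  have x0 : 0 <= x by move: xI; rewrite /= in_itv /= andbT.
  apply: cvgM; first by move/subspace_continuousP: psi_cts; apply.
  apply: cvgV; first by rewrite gt_eqF ?el0.
  have idx : l @[l --> within `[0, +oo[ (nbhs x)] --> x by exact: cvg_within.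
  by apply: cvgM; apply: cvgD => //; exact: cvg_cst.
- move=> x y x0 xy; have y0 := le_trans x0 xy.
  apply: ler_pM; [exact/ltW/psi_gt0 | | exact: psi_dec |].
    by rewrite invr_ge0 ltW ?el0.
  rewrite lef_pV2 ?posrE ?el0 // ler_sqr ?nnegrE ?addr_ge0 ?(ltW e0) //.
  by rewrite lerD2l.
- by move=> x x0; rewrite divr_gt0 ?psi_gt0 ?el0.
Qed.

End DecreasingClass.

Theorem theorem4p1 (R : realType) (X Y : hilbertType R)
  (D : set X) (A : X -> X)
  (D_subspace : linear_subspace D)
  (A_linear : linear_on D A)
  (A_self_adjoint : self_adjoint D A)
  (A_positive : strictly_positive D A)
  (A_resolvent : has_compact_resolvent D A)
  (lam : nat -> R) (phi : nat -> X)
  (lam_nondecreasing : nondecreasing_seq lam)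
  (phi_basis : orthonormal_basis phi)
  (phi_eigen : forall k, D (phi k) /\ A (phi k) = (lam k)%:C *: phi k)
  (U : R -> X -> X)
  (U_group : unitary_group U)
  (U_generator : generated_by_i D A U)
  (C : X -> Y)
  (C_bounded : bounded_on_domain D A C)
  (C_admissible : admissible D C U)
  (eps : R) (eps_gt0 : 0 < eps)
  (psi : R -> R) (psi_class : decreasing_class psi) :
  (spectrally_coercive_with D A C (fun=> eps) psi ->
     weakly_spectrally_coercive D lam phi C) /\
  (weakly_spectrally_coercive_with D lam phi C eps psi ->
     spectrally_coercive D A C).
Proof.
have [_ psi_dec psi_gt0] := psi_class.
split=> [coercive|weak].
  (* Both [e <= 1 / 2] and [e <= eps / 2] hold, so [e ^+ 2 <= eps / 4] whether [eps] is large or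
     small. *)
  pose e := Num.min 1 eps / 2.
  have [e0 e_eps] : 0 < e /\ e ^+ 2 < eps.
    rewrite /e; case: (leP 1 eps) => ?; split; nra.
  exists e, (fun l => psi (l + e)); split=> //.
    exact: decreasing_class_shift (ltW e0) psi_class.
  move=> l l0 c z zE Dz z0.
  have [|spread freq_le] := spectral_spread A_self_adjoint A_positive phi_basis
    phi_eigen l e z (ltW e0) Dz z0.
    by move=> k; apply: (coef_cvg_eq0 phi_basis.1 _ _ _ _ zE).
  (* Monotonicity of [psi] is available only between nonnegative points. *)
  have freq0 := frequency_ge0 A_positive z Dz z0.
  apply: le_trans (coercive z Dz z0 (le_lt_trans spread e_eps)).
  by rewrite ler_wpM2r ?sqr_ge0 // psi_dec.
have [C_linear [M0 C_le]] := C_bounded.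
(* [M0] may fail to be positive, and the bound is later divided by. *)
pose M := Num.max M0 1.
have M1 : 1 <= M by rewrite le_max lexx orbT.
have {}C_le z : D z -> rnorm (C z) <= M * rnorm (A z).
  move=> Dz; apply: le_trans (C_le z Dz) _.
  by rewrite ler_wpM2r ?rnorm_ge0 // le_max lexx.
have psi0 : 0 < psi 0 by exact: psi_gt0.
(* The two bounds on kappa make, respectively, |C z2| at most
   sqrt (psi l) |z| / 4 and |z2| at most |z| / 2, where z2 is the far part. *)
pose kappa := Num.min (eps ^+ 2 / (16 * M ^+ 2)) (eps ^+ 4 / (4 * psi 0)).
have kappa0 : 0 < kappa.
  rewrite lt_min !divr_gt0 ?mulr_gt0 ?exprn_gt0 //; lra.
have kappaM : kappa * (16 * M ^+ 2) <= eps ^+ 2.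
  by rewrite -ler_pdivlMr ?mulr_gt0 ?exprn_gt0 ?ge_min ?lexx //; lra.
have kappapsi : kappa * (4 * psi 0) <= eps ^+ 4.
  by rewrite -ler_pdivlMr ?mulr_gt0 // ge_min lexx orbT.
(* The factor [16^-1] is the square of 1/4 = 1/2 - 1/4: [C z1] contributes at least one half of
   [sqrt (psi l) |z|], and [C z2] removes at most one quarter. *)
exists (fun l => kappa * (psi l / (eps + l) ^+ 2)), (fun l => 16^-1 * psi l).
split.
- by apply: decreasing_class_scale => //; apply: decreasing_class_div.
- by apply: decreasing_class_scale => //; rewrite invr_gt0.
move=> z Dz z0.
have l0 := frequency_ge0 A_positive z Dz z0.
have shiftE := sqr_rnorm_shift A_positive (frequency A z) z Dz z0.
have n0 := rnorm_gt0 _ z0.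
move: (frequency A z) l0 shiftE => l l0 shiftE small.
have [z1 [z2 [zE Dz1 Dz2 z1_cvg z2E]]] := spectral_split D_subspace
  lam_nondecreasing phi_basis phi_eigen l eps z Dz.
have [z2_le Az2_le] := spectral_tail A_self_adjoint phi_basis
  phi_eigen l eps z z2 eps_gt0 Dz Dz2 z2E.
set s := rnorm (A z - l%:C *: z) in shiftE z2_le Az2_le.
have el0 : 0 < (eps + l) ^+ 2 by rewrite exprn_gt0 // ltr_wpDr.
have psil0 : 0 < psi l by exact: psi_gt0.
have psil : psi l <= psi 0 by exact: psi_dec.
have s0 : 0 <= s by exact: rnorm_ge0.
have s_lt : s ^+ 2 * (eps + l) ^+ 2 <= kappa * psi l * rnorm z ^+ 2.
  rewrite -ler_pdivlMr // mulrAC -[kappa * _ / _]mulrA.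
  rewrite -ler_pdivrMr ?exprn_gt0 //; apply: le_trans (ltW small).
  rewrite shiftE mulrDl mulfK ?expf_neq0 ?gt_eqF //; lra.
(* Here [(eps + l) ^+ 2 >= eps ^+ 2] and [psi l <= psi 0], so a [kappa] independent of [l]
   suffices. *)
have s_le : s <= eps / 2 * rnorm z.
  rewrite -ler_sqr ?nnegrE ?mulr_ge0 ?divr_ge0 ?(ltW eps_gt0) ?(ltW n0) //.
  have e2 : 0 < eps ^+ 2 by rewrite exprn_gt0.
  rewrite -(ler_pM2r e2); apply: (@le_trans _ _ (s ^+ 2 * (eps + l) ^+ 2)).
    by rewrite ler_wpM2l ?sqr_ge0 // ler_sqr ?nnegrE; lra.
  apply: le_trans s_lt _.
  rewrite exprMn [leRHS]mulrAC ler_wpM2r ?sqr_ge0 //.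
  have : kappa * psi l <= kappa * psi 0 by rewrite ler_pM2l.
  by nra.
have z2_half : rnorm z2 <= rnorm z / 2.
  by rewrite -(ler_pM2l eps_gt0); apply: le_trans z2_le _; lra.
have z1_half : rnorm z / 2 <= rnorm z1.
  by have := rnormD z1 z2; rewrite -zE; lra.
have z1_neq0 : z1 <> 0.
  by move=> z10; move: z1_half; rewrite z10 /rnorm normr0 /=; lra.
have Cz1 : psi l * rnorm z1 ^+ 2 <= rnorm (C z1) ^+ 2 by exact: (weak l l0 _ _ z1_cvg).
pose p := Num.sqrt (psi l).
have p0 : 0 <= p by exact: sqrtr_ge0.
have pE : p ^+ 2 = psi l by rewrite sqr_sqrtr // ltW.
have pz1 : p * rnorm z1 <= rnorm (C z1).
  by rewrite -ler_sqr ?nnegrE ?mulr_ge0 ?rnorm_ge0 // exprMn pE.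
(* Writing [A z2] as [(A z2 - l z2) + l z2], the two terms times [eps] are at most [eps * s] and
   [l * s]. The factor [eps + l] is what the denominator of the threshold cancels. *)
have Az2 : eps * rnorm (A z2) <= s * (eps + l).
  have : rnorm (A z2) <= s + l * rnorm z2.
    rewrite -[A z2](subrK (l%:C *: z2)) -[in leRHS](ger0_norm l0) -rnormZ.
    by apply: le_trans (rnormD _ _) _; rewrite lerD2r.
  by nra.
have Cz2 : rnorm (C z2) <= p / 4 * rnorm z.
  apply: le_trans (C_le _ Dz2) _; rewrite -(ler_pM2l eps_gt0).
  rewrite -ler_sqr ?nnegrE ?mulr_ge0 ?divr_ge0 ?rnorm_ge0 ?(ltW eps_gt0) //; last lra.
  rewrite mulrCA !exprMn pE.
  have : (eps * rnorm (A z2)) ^+ 2 <= (s * (eps + l)) ^+ 2.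
    by rewrite ler_sqr ?nnegrE ?mulr_ge0 ?rnorm_ge0 //; lra.
  rewrite !exprMn => /le_trans/(_ s_lt) h.
  apply: le_trans (ler_wpM2l (sqr_ge0 M) h) _.
  have pn : 0 <= psi l * rnorm z ^+ 2 by rewrite mulr_ge0 ?sqr_ge0 // ltW.
  by have := ler_wpM2r pn kappaM; lra.
have Cz : C z1 = C z - C z2.
  have -> : z1 = (-1) *: z2 + z by rewrite zE scaleN1r addrC addrK.
  by rewrite C_linear // scaleN1r addrC.
have Cz_ge : p / 4 * rnorm z <= rnorm (C z).
  have := ler_wpM2l p0 z1_half.
  by have := rnormD (C z) (- C z2); rewrite -Cz rnormN; lra.
have -> : 16^-1 * psi l * rnorm z ^+ 2 = (p / 4 * rnorm z) ^+ 2.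
  by rewrite !exprMn pE; field.
by rewrite ler_sqr ?nnegrE ?mulr_ge0 ?rnorm_ge0 ?divr_ge0.
Qed.
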